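(* The following two assertions are equivalent: (1) for every finite simple graph $G$, one has $\omega(I_{\mathcal{M}_G})\le 4$; (2) for every finite simple graph $G$, one has $\omega(I_{\mathcal{P}_G})\le 4$.
   Context: For a simple graph $G$ with edge set $E(G)=\{e_1,\dots,e_n\}$, a matching of $G$ is a (possibly empty) set of pairwise non-adjacent edges; it is perfect if it covers every vertex. For $M\subset E(G)$ put $\rho(M)=\sum_{e_j\in M}\mathbf{e}_j\in\mathbb{R}^n$. The matching polytope is $\mathcal{M}_G=\mathrm{conv}\{\rho(M): M \text{ a matching of } G\}$ and the perfect matching polytope is $\mathcal{P}_G=\mathrm{conv}\{\rho(M): M \text{ a perfect matching of } G\}$ (possibly empty, in which case $I_{\mathcal{P}_G}=\{0\}$). Toric ideal: for a lattice polytope $\mathcal{P}\subset\mathbb{R}^n_{\ge0}$ with $\mathcal{P}\cap\mathbb{Z}^n=\{\mathbf{a}_1,\dots,\mathbf{a}_N\}$ and a field $\mathbb{K}$, $I_{\mathcal{P}}$ is the kernel of the $\mathbb{K}$-algebra map $\mathbb{K}[x_1,\dots,x_N]\to\mathbb{K}[t_1,\dots,t_n,s]$, $x_i\mapsto \mathbf{t}^{\mathbf{a}_i}s$, with $\deg x_i=1$. For a homogeneous ideal $I$, $\omega(I)$ is the maximal degree of minimal generators of $I$; by convention $\omega(\{0\})=2$ (so $\omega(I_{\mathcal P})\ge 2$ always). *)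

(* Defs.v *)
From mathcomp Require Import all_boot all_order all_algebra.
From mathcomp Require Import mpoly.
From mathcomp Require Import reals.

Set Implicit Arguments.
Unset Strict Implicit.
Unset Printing Implicit Defensive.

Import GRing.Theory Num.Theory.

Local Open Scope ring_scope.

Section Matchings.
Variables (V : finType) (e : rel V).

(* Qualified: mpoly shadows [symmetric] (symmetric polynomials). *)
Definition simple_graph : Prop := ssrbool.symmetric e /\ irreflexive e.

Definition edges : {set {set V}} := [set [set x; y] | x in V, y in V & e x y].

(* Distinct edges are non-adjacent exactly when they are disjoint as sets of
   vertices, so pairwise non-adjacency is [trivIset]. *)
Definition is_matching (M : {set {set V}}) : bool :=
  (M \subset edges) && trivIset M.

Definition is_perfect_matching (M : {set {set V}}) : bool :=
  is_matching M && (cover M == [set: V]).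

End Matchings.

Definition conv (R : realType) (n : nat) (S : 'rV[R]_n -> Prop)
    (x : 'rV[R]_n) : Prop :=
  exists (k : nat) (c : 'I_k -> R) (v : 'I_k -> 'rV[R]_n),
    [/\ forall i, S (v i), forall i, 0 <= c i, \sum_i c i = 1
      & x = \sum_i c i *: v i].

Section MatchingPolytopes.
Variables (R : realType) (V : finType) (e : rel V).

(* The coordinates of R^n are labelled by the edges through [enum_val]. *)
Definition rho (M : {set {set V}}) : 'rV[R]_#|edges e| :=
  \sum_(j < #|edges e| | enum_val j \in M) delta_mx 0 j.

Definition matching_polytope : 'rV[R]_#|edges e| -> Prop :=
  conv (fun x => exists2 M, is_matching e M & x = rho M).

Definition perfect_matching_polytope : 'rV[R]_#|edges e| -> Prop :=
  conv (fun x => exists2 M, is_perfect_matching e M & x = rho M).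

End MatchingPolytopes.

(* [a] lists the lattice points of [P] without repetition.  As [P] is meant to
   lie in the nonnegative orthant, its lattice points are vectors of naturals,
   i.e. exponents of monomials in n variables. *)
Definition lattice_points (R : realType) (n N : nat) (P : 'rV[R]_n -> Prop)
    (a : N.-tuple 'X_{1..n}) : Prop :=
  uniq a /\ forall m : 'X_{1..n}, m \in a <-> P (\row_j (m j)%:R).

Section ToricIdeal.
Variables (K : fieldType) (n N : nat) (a : N.-tuple 'X_{1..n}).

(* In K[t_1, ..., t_n, s], realized as {mpoly K[n.+1]}, the variable s is the
   last one, 'X_ord_max. *)
Definition toric_map (p : {mpoly K[N]}) : {mpoly K[n.+1]} :=
  p \mPo [tuple mwiden 'X_[tnth a i] * 'X_ord_max | i < N].

Definition toric_ideal (p : {mpoly K[N]}) : Prop := toric_map p = 0.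

End ToricIdeal.

Section MinimalGenerators.
Variables (K : fieldType) (N : nat).
Implicit Types (I : {mpoly K[N]} -> Prop) (gs hs : seq {mpoly K[N]}).

Definition generates I gs : Prop :=
  forall p, I p <->
    exists c : 'I_(size gs) -> {mpoly K[N]}, p = \sum_i c i * gs`_i.

Definition minimal_generators I gs : Prop :=
  [/\ forall g, g \in gs -> exists d, g \is d.-homog,
      generates I gs
    & forall hs, subseq hs gs -> generates I hs -> hs = gs].

(* [is_omega I w] says that omega(I) = w, with omega({0}) = 2.  The degrees in
   a minimal system of homogeneous generators do not depend on the system.
   [msize g] is one more than the degree of a nonzero [g]. *)
Definition is_omega I (w : nat) : Prop :=
  ((forall p, I p <-> p = 0) /\ w = 2%N) \/
  ((exists2 p, I p & p != 0) /\
   exists2 gs, minimal_generators I gs & w = \max_(g <- gs) (msize g).-1).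

End MinimalGenerators.

(* omega(I_P) = w; reordering the lattice points only renames the variables,
   so the choice of [a] is immaterial. *)
Definition is_toric_omega (R : realType) (K : fieldType) (n : nat)
    (P : 'rV[R]_n -> Prop) (w : nat) : Prop :=
  exists (N : nat) (a : N.-tuple 'X_{1..n}),
    lattice_points P a /\ is_omega (@toric_ideal K n N a) w.

(* Main.v *)
(** If [iota : A -> B] and [pi : B -> A] are maps of polynomial rings, given on
    variables, with [pi \o iota = id], carrying the ideals [I] and [J] into
    each other, then [pi] maps generators of [J] to generators of [I] without
    raising degrees, so [omega I <= omega J].  For (1) => (2), [P_G] is a face
    of [M_G], [iota] is the inclusion of variables and [pi] kills the variables
    off the face.  For (2) => (1), [J] is the ideal of the perfect matchings of
    the prism over [G]: [iota] sends a matching [M] to two copies of [M]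
    completed by the rungs at the uncovered vertices, and [pi] restricts to the
    first copy.  The binomial generators are never needed: a linear map given on
    monomials kills a toric ideal as soon as it is constant on the fibres of the
    toric map. *)

Require Import Defs.
From mathcomp Require Import all_boot all_order all_algebra.
From mathcomp Require Import mpoly.
From mathcomp Require Import boolp reals.

Set Implicit Arguments.
Unset Strict Implicit.
Unset Printing Implicit Defensive.

Import Order.TTheory GRing.Theory Num.Theory.

Local Open Scope ring_scope.

(** * Minimal homogeneous generators and retracts of ideals *)

Section Generators.
Variables (K : fieldType) (N : nat).
Implicit Types (I : {mpoly K[N]} -> Prop).

(** As long as a proper subsequence still generates, pass to it; the length drops each time, so the
    process ends. *)
Lemma exists_minimal_generators I gs :
    (forall g, g \in gs -> exists d, g \is d.-homog) -> generates I gs ->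
  exists2 hs, subseq hs gs & minimal_generators I hs.
Proof.
have [n] := ubnP (size gs); elim: n gs => // n IHn gs lt_gs_n homg genI.
have [[hs [sub_hs gen_hs neq_hs]] | no_hs] :=
  EM (exists hs, [/\ subseq hs gs, generates I hs & hs <> gs]).
  have lt_hs : (size hs < size gs)%N.
    rewrite ltn_neqAle size_subseq // andbT.
    by apply/eqP => eq_sz; apply/neq_hs/eqP; rewrite -(size_subseq_leqif sub_hs).2 eq_sz.
  have [|g hs_g|ks sub_ks min_ks] := IHn hs _ _ gen_hs.
  - exact: leq_trans lt_hs _.
  - exact/homg/(mem_subseq sub_hs).
  - by exists ks => //; apply: subseq_trans sub_ks sub_hs.
exists gs => //; split=> // hs sub_hs gen_hs.
by have [//|neq_hs] := EM (hs = gs); case: no_hs; exists hs.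
Qed.

Lemma generates_mem I gs g : generates I gs -> g \in gs -> I g.
Proof.
move=> genI gs_g; apply/genI; have lt_g : (index g gs < size gs)%N by rewrite index_mem.
exists (fun i => (i == Ordinal lt_g)%:R).
rewrite (bigD1 (Ordinal lt_g)) //= eqxx mul1r nth_index // big1 ?addr0 // => i.
by move=> /negPf->; rewrite mul0r.
Qed.

End Generators.

(** Applying [pi] to an expansion of [iota q] expands [q] itself, so the images of generators of [J]
    generate [I]; pruning them to a minimal system cannot raise the maximal degree. The bound
    [2 <= w] covers the zero ideal, whose omega is 2 by convention. *)
Lemma is_omega_retract (K : fieldType) (N N' : nat) (I : {mpoly K[N]} -> Prop)
    (J : {mpoly K[N']} -> Prop) (iota : {mpoly K[N]} -> {mpoly K[N']})
    (pi : {rmorphism {mpoly K[N']} -> {mpoly K[N]}}) w :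
    cancel iota pi ->
    (forall d p, p \is d.-homog -> pi p \is d.-homog) ->
    (forall p, I p -> J (iota p)) -> (forall q, J q -> I (pi q)) ->
    I 0 -> (forall p q r, I p -> I q -> I (p + r * q)) -> (2 <= w)%N ->
  (exists2 w', is_omega J w' & (w' <= w)%N) ->
  exists2 w', is_omega I w' & (w' <= w)%N.
Proof.
move=> iotaK pi_homog sIJ sJI I0 ID w_ge2 [w' omegaJ le_w'w].
have [[p Ip p_neq0] | I_eq0] := EM (exists2 p, I p & p != 0); last first.
  exists 2%N => //; left; split=> // p; split=> [Ip | -> //].
  by apply/eqP/negPn/negP => p_neq0; case: I_eq0; exists p.
case: omegaJ => [[J_eq0 _] | [_ [gs [homg genJ _] def_w']]].
  by case/eqP: p_neq0; rewrite -(iotaK p) (J_eq0 (iota p)).1 ?rmorph0 //; apply: sIJ.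
(* Zero is homogeneous of every degree, so the degree bound is claimed only for nonzero images. *)
have gs_homog h : h \in map pi gs -> exists2 d, h \is d.-homog & (h == 0) || (d <= w)%N.
  case/mapP => g gs_g ->; have [d homg_d] := homg g gs_g; exists d; first exact: pi_homog.
  have [->|g_neq0] := eqVneq g 0; first by rewrite rmorph0 eqxx.
  apply/orP; right; apply: leq_trans le_w'w; rewrite def_w'.
  rewrite (dhomog_uniq g_neq0 homg_d (dhomog_msize homg_d)).
  by apply: (@leq_bigmax_seq _ gs xpredT (fun g => (msize g).-1)).
have genI : generates I (map pi gs).
  move=> q; split=> [Iq | [c ->]].
    have /genJ[c def_q] := sIJ q Iq.
    have sz_gs : size (map pi gs) = size gs by rewrite size_map.
    exists (fun i => pi (c (cast_ord sz_gs i))).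
    rewrite -[q in LHS]iotaK def_q rmorph_sum (reindex (cast_ord sz_gs)) /=.
      by apply: eq_bigr => i _; rewrite rmorphM (nth_map 0) // -sz_gs.
    by apply: onW_bij; apply: inj_card_bij; [apply: cast_ord_inj | rewrite !card_ord sz_gs].
  apply: big_ind => // [x y Ix Iy | i _]; first by rewrite -[y]mul1r; apply: ID.
  rewrite -[_ * _]add0r; apply: ID => //.
  have lt_i : (i < size gs)%N by case: i => i /=; rewrite size_map.
  by rewrite (nth_map 0) //; apply/sJI/(generates_mem genJ)/mem_nth.
have [|hs sub_hs min_hs] := exists_minimal_generators _ genI.
  by move=> h /gs_homog[d]; exists d.
exists (\max_(g <- hs) (msize g).-1)%N.
  by right; split; [exists p | exists hs].
apply/bigmax_leqP_seq => h /(mem_subseq sub_hs)/gs_homog[d homh].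
(* A zero generator contributes [0.-1 = 0] to the maximum. *)
have [-> | h_neq0] := eqVneq h 0; first by rewrite msize0.
by rewrite (dhomog_uniq h_neq0 (dhomog_msize homh) homh).
Qed.

(** * Substitutions of variables on toric ideals *)

Section Renaming.
Variables (K : fieldType).

(** The value [None] sends a variable to 0, which is how the variables off a face are killed. *)
Definition rename_vars N N' (g : 'I_N' -> option 'I_N) (p : {mpoly K[N']}) : {mpoly K[N]} :=
  p \mPo [tuple oapp (fun i => 'X_i) 0 (g j) | j < N'].

(** The exponent of the monomial [t^(a_i) s], with [s] in the last coordinate. *)
Definition toric_gen n N (a : N.-tuple 'X_{1..n}) (i : 'I_N) : 'X_{1..n.+1} :=
  (mnmwiden (tnth a i) + U_(ord_max))%MM.

Lemma toric_map_rename_X n N N' (g : 'I_N' -> option 'I_N) (a : N.-tuple 'X_{1..n}) m :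
  toric_map a (rename_vars g 'X_[m]) =
  \prod_(j < N') oapp (fun i => 'X_[K, toric_gen a i]) 0 (g j) ^+ m j.
Proof.
rewrite /toric_map /rename_vars comp_mpolyX rmorph_prod /=; apply: eq_bigr => j _.
rewrite rmorphXn /= tnth_mktuple; congr (_ ^+ _).
case: (g j) => [i|] /=; last by rewrite rmorph0.
by rewrite comp_mpolyXU -tnth_nth tnth_mktuple mwidenX mpolyXD.
Qed.

(** The exponent of [s] records the degree of [m], so a fibre of the toric map is given by the
    degree and the weighted sums of the lattice points. *)
Lemma toric_gen_sum n N (a : N.-tuple 'X_{1..n}) (m : 'X_{1..N}) :
  (\sum_j toric_gen a j *+ m j =
   mnmwiden [multinom (\sum_j m j * tnth a j c)%N | c < n] + U_(ord_max) *+ mdeg m)%MM.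
Proof.
apply/mnmP => c; rewrite mnm_sumE mnmDE mulmnE.
under eq_bigr => j _ do rewrite mulmnE mnmDE mulnDl.
rewrite big_split /= mnm1E mdegE big_distrr /=; congr (_ + _)%N.
have [c' ->|->] := unliftP ord_max c.
  have -> : lift ord_max c' = widen_ord (leqnSn n) c'.
    by apply: val_inj => /=; rewrite /bump leqNgt ltn_ord.
  rewrite mnmwiden_widen mnmE; apply: eq_bigr => j _.
  by rewrite mnmwiden_widen mulnC.
by rewrite mnmwiden_ordmax big1 // => j _; rewrite mnmwiden_ordmax.
Qed.

Lemma mpolyX_sum n (I : Type) (r : seq I) (F : I -> 'X_{1..n}) :
  'X_[K, \sum_(i <- r) F i] = \prod_(i <- r) 'X_[F i].
Proof. exact: (big_morph _ (@mpolyXD _ _) (mpolyX0 _ _)). Qed.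

Lemma toric_map_X n N (a : N.-tuple 'X_{1..n}) m :
  toric_map a 'X_[K, m] = 'X_[\sum_i toric_gen a i *+ m i].
Proof.
rewrite /toric_map comp_mpolyX mpolyX_sum; apply: eq_bigr => i _.
by rewrite tnth_mktuple mwidenX -mpolyXD mpolyXn.
Qed.

(* The values of [L] on the fibres of [A] define a linear map through which [L]
   factors. *)
Lemma linear_monomial_factor N N' k (A : 'X_{1..N} -> 'X_{1..k})
    (L : {linear {mpoly K[N]} -> {mpoly K[N']}}) p :
    (forall m m', A m = A m' -> L 'X_[m] = L 'X_[m']) ->
  \sum_(m <- msupp p) p@_m *: 'X_[K, A m] = 0 -> L p = 0.
Proof.
move=> LA Ap0.
(* [F] reads [L] off any preimage under [A]; its value 0 off the image of [A] is arbitrary. *)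
pose F u := if pselect (exists m, A m = u) is left ex_m then L 'X_[projT1 (cid ex_m)] else 0.
have LE m : L 'X_[m] = F (A m).
  rewrite /F; case: pselect => [ex_m | []]; last by exists m.
  by case: cid => m' /= /esym/LA.
(* Bounding the degrees of all [A m] makes the sum over target exponents finite. *)
pose d := (\max_(m <- msupp p) mdeg (A m)).+1.
rewrite {1}(mpolyE p) linear_sum /=.
transitivity (\sum_(u : 'X_{1..k < d}) (\sum_(m <- msupp p) p@_m *: 'X_[K, A m])@_u *: F u);
  last by rewrite Ap0 big1 // => u _; rewrite mcoeff0 scale0r.
under [RHS]eq_bigr => u _ do rewrite raddf_sum scaler_suml /=.
rewrite exchange_big /= big_seq [RHS]big_seq; apply: eq_bigr => m p_m.
have lt_Am : (mdeg (A m) < d)%N.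
  by rewrite ltnS (@leq_bigmax_seq _ _ xpredT (fun m => mdeg (A m))).
rewrite linearZ /= LE (bigD1 (BMultinom lt_Am)) //= big1 ?addr0 => [|u neq_u].
  by rewrite mcoeffZ mcoeffX eqxx mulr1.
rewrite mcoeffZ mcoeffX; case: eqP => [eq_u | _]; last by rewrite mulr0 scale0r.
by case/eqP: neq_u; apply: val_inj.
Qed.

(* The condition says that [g] respects the relation of having the same
   monomial image under the toric map, where a monomial using a variable that
   [g] kills counts as [0]. *)
Definition fibre_compatible n n' N N' (b : N'.-tuple 'X_{1..n'})
    (a : N.-tuple 'X_{1..n}) (g : 'I_N' -> option 'I_N) : Prop :=
  forall m m' : 'X_{1..N'}, mdeg m = mdeg m' ->
    (forall c, \sum_j m j * tnth b j c = \sum_j m' j * tnth b j c)%N ->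
  (forall j, (0 < m j)%N -> g j) ->
  (forall j, (0 < m' j)%N -> g j) /\
  forall c, (\sum_j m j * oapp (fun i => tnth a i c) 0 (g j) =
             \sum_j m' j * oapp (fun i => tnth a i c) 0 (g j))%N.

(** Renaming followed by the toric map of [a] is constant on the fibres of the toric map of [b]: two
    monomials of one fibre are either both killed or have the same image. *)
Lemma toric_ideal_rename n n' N N' (b : N'.-tuple 'X_{1..n'})
    (a : N.-tuple 'X_{1..n}) (g : 'I_N' -> option 'I_N) q :
    fibre_compatible b a g -> toric_ideal b q ->
  @toric_ideal K n N a (rename_vars g q).
Proof.
move=> compat.
have killed (m : 'X_{1..N'}) : ~ (forall j, (0 < m j)%N -> g j) ->
    toric_map a (rename_vars g 'X_[m]) = 0.
  move=> /existsNP[j /not_implyP[m_j /negP g_j]].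
  rewrite toric_map_rename_X (bigD1 j) //=; case: (g j) g_j => // _.
  by rewrite expr0n gtn_eqF // mul0r.
have kept (m : 'X_{1..N'}) : (forall j, (0 < m j)%N -> g j) ->
    toric_map a (rename_vars g 'X_[m]) =
    'X_[mnmwiden [multinom (\sum_j m j * oapp (fun i => tnth a i c) 0 (g j))%N | c < n]
        + U_(ord_max) *+ mdeg m].
  (* The padding by [0] at killed variables is harmless, since they do not occur in [m]. *)
  move=> g_m; pose b' := [tuple oapp (tnth a) 0%MM (g j) | j < N'].
  rewrite toric_map_rename_X; transitivity 'X_[K, \sum_j toric_gen b' j *+ m j].
    rewrite mpolyX_sum; apply: eq_bigr => j _; rewrite -mpolyXn.
    case: (posnP (m j)) => [-> | /g_m]; first by rewrite !expr0.
    by rewrite /toric_gen tnth_mktuple; case: (g j).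
  rewrite toric_gen_sum; congr 'X_[mnmwiden _ + _]; apply/mnmP => c; rewrite !mnmE.
  by apply: eq_bigr => j _; rewrite tnth_mktuple; case: (g j) => //=; rewrite mnm0E.
move=> Jq; apply: (linear_monomial_factor
  (A := fun m : 'X_{1..N'} => (\sum_j toric_gen b j *+ m j)%MM)
  (L := toric_map a \o rename_vars g)) => [m m'|].
  rewrite !toric_gen_sum => /mnmP eqA.
  rewrite -[LHS]/(toric_map a (rename_vars g 'X_[m])).
  rewrite -[RHS]/(toric_map a (rename_vars g 'X_[m'])).
  have eq_deg : mdeg m = mdeg m'.
    by have := eqA ord_max; rewrite !mnmDE !mulmnE !mnmwiden_ordmax mnm1E eqxx !mul1n.
  have eq_sum c : (\sum_j m j * tnth b j c = \sum_j m' j * tnth b j c)%N.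
    have := eqA (widen_ord (leqnSn n') c).
    rewrite !mnmDE !mulmnE !mnmwiden_widen mnm1E !mnmE.
    by rewrite -val_eqE /= gtn_eqF ?ltn_ord // !mul0n !addn0.
  (* The compatibility is stated one way only; when [m] is killed, it is applied to the swapped pair
     to see that [m'] is killed too. *)
  have [g_m | g'm] := EM (forall j, (0 < m j)%N -> g j); last first.
    rewrite (killed m) // killed // => g_m'; apply: g'm.
    by have [] := compat m' m (esym eq_deg) (fun c => esym (eq_sum c)) g_m'.
  have [g_m' eq_sum'] := compat _ _ eq_deg eq_sum g_m.
  rewrite !kept // eq_deg; congr 'X_[mnmwiden _ + _]; apply/mnmP => c.
  by rewrite !mnmE.
rewrite -[RHS]Jq [q in RHS]mpolyE /toric_map linear_sum /=.
by apply: eq_bigr => m _; rewrite linearZ /= -toric_map_X.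
Qed.

End Renaming.

Lemma toric_omega_retract (K : fieldType) n n' N N' (a : N.-tuple 'X_{1..n})
    (b : N'.-tuple 'X_{1..n'}) (f : 'I_N -> 'I_N') (g : 'I_N' -> option 'I_N) w :
    (forall i, g (f i) = Some i) -> fibre_compatible a b (Some \o f) ->
    fibre_compatible b a g -> (2 <= w)%N ->
  (exists2 w', is_omega (@toric_ideal K n' N' b) w' & (w' <= w)%N) ->
  exists2 w', is_omega (@toric_ideal K n N a) w' & (w' <= w)%N.
Proof.
move=> fK compat_f compat_g; apply: (is_omega_retract (iota := rename_vars (Some \o f))
  (pi := comp_mpoly [tuple oapp (fun i => 'X_i) 0 (g j) | j < N'])).
- move=> p; rewrite /rename_vars {1}(mpolyE p) linear_sum /= linear_sum [RHS]mpolyE /=.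
  apply: eq_bigr => m _; rewrite linearZ /= linearZ /= comp_mpolyX rmorph_prod /= mpolyXE_id.
  congr (_ *: _); apply: eq_bigr => i _; rewrite rmorphXn /= tnth_mktuple /=.
  by rewrite comp_mpolyXU -tnth_nth tnth_mktuple fK.
- move=> d p /dhomogP homp /=; rewrite [p]mpolyE linear_sum big_seq.
  apply: rpred_sum => m p_m; rewrite linearZ /=; apply: dhomogZ.
  have <- : mdeg m = d by exact: homp.
  rewrite comp_mpolyX mdegE; elim/big_rec2: _ => [|j d' r _ homr]; first exact: dhomog1.
  apply: dhomogM => //; rewrite -[X in X.-homog]mul1n; apply: dhomogMn.
  (* A killed variable goes to 0, which is also homogeneous of degree 1. *)
  rewrite tnth_mktuple; case: (g j) => [i|] /=; last exact: dhomog0.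
  by rewrite dhomogX /= mdeg1.
- by move=> p; apply: toric_ideal_rename.
- by move=> q; apply: toric_ideal_rename.
- by rewrite /toric_ideal /toric_map rmorph0.
- by move=> p q r; rewrite /toric_ideal /toric_map rmorphD rmorphM /= => -> ->; rewrite mulr0 addr0.
Qed.

(** * Lattice points of polytopes spanned by edge sets *)

Section EdgeSetPolytopes.
Variables (R : realType) (V : finType) (e : rel V).
Implicit Types (M : {set {set V}}) (P : pred {set {set V}}).

Definition indicator M : 'X_{1..#|edges e|} :=
  [multinom (enum_val j \in M : nat) | j < #|edges e|].

(** Taking for [P] the matchings or the perfect matchings gives the two polytopes of the theorem by
    conversion. *)
Definition edge_set_polytope P : 'rV[R]_#|edges e| -> Prop :=
  conv (fun x => exists2 M, P M & x = rho R e M).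

Lemma rhoE M j : rho R e M 0 j = (enum_val j \in M)%:R.
Proof.
rewrite /rho summxE big_mkcond (bigD1 j) //= big1 => [|i neq_ij].
  by rewrite addr0 mxE !eqxx; case: ifP.
by case: ifP => // _; rewrite mxE eq_sym (negPf neq_ij) andbF.
Qed.

(** A 0/1 polytope has no lattice points besides its vertices: if [M i] has positive weight, an
    integral coordinate averaging zeros and ones must agree with that of [M i], being positive and
    at most 1, or less than 1. *)
Lemma edge_set_polytopeP P (m : 'X_{1..#|edges e|}) :
  edge_set_polytope P (\row_j (m j)%:R) <-> exists2 M, P M & m = indicator M.
Proof.
split=> [[k [c [v [Pv c_ge0 sum_c def_m]]]] | [M PM ->]]; last first.
  exists 1%N, (fun=> 1), (fun=> rho R e M); split=> //; first by move=> _; exists M.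
    by rewrite big_ord1.
  by rewrite big_ord1 scale1r; apply/rowP => j; rewrite rhoE mxE mnmE.
have /fin_all_exists2[M PM def_v] := Pv.
have mE j : (m j)%:R = \sum_i c i * (enum_val j \in M i)%:R :> R.
  have /rowP/(_ j) := def_m; rewrite mxE => ->; rewrite summxE.
  by apply: eq_bigr => i _; rewrite mxE def_v rhoE.
have [i c_i] : exists i, 0 < c i.
  apply: contrapT => /forallNP c_le0; have := oner_neq0 R.
  rewrite -sum_c big1 ?eqxx // => i _; apply/eqP.
  by move/negP: (c_le0 i); rewrite lt_neqAle c_ge0 andbT negbK eq_sym.
exists (M i) => //; apply/mnmP => j; rewrite mnmE.
have [Mi_j | Mi_j] := boolP (enum_val j \in M i).
  apply/eqP; rewrite eqn_leq -(ler_nat R) -(ltr_nat R) mE; apply/andP; split.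
    rewrite -[X in _ <= X]sum_c ler_sum // => i' _.
    by case: (_ \in _); rewrite ?mulr1 ?mulr0.
  rewrite (bigD1 i) //= Mi_j mulr1 ltr_pwDl // sumr_ge0 // => i' _.
  by rewrite mulr_ge0 ?ler0n.
apply/eqP; rewrite -leqn0 -ltnS -(ltr_nat R) mE -[X in _ < X]sum_c -subr_gt0 -sumrB.
rewrite (bigD1 i) //= (negPf Mi_j) mulr0 subr0 ltr_pwDl // sumr_ge0 // => i' _.
by case: (_ \in _); rewrite ?mulr1 ?mulr0 ?subrr ?subr0.
Qed.

Lemma indicator_inj M M' :
  M \subset edges e -> M' \subset edges e -> indicator M = indicator M' -> M = M'.
Proof.
move=> sM sM' /mnmP eqMM'; apply/setP => c.
have [E_c | E'c] := boolP (c \in edges e).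
  by have := eqMM' (enum_rank_in E_c c); rewrite !mnmE enum_rankK_in //; do 2!case: (_ \in _).
by rewrite (negPf (contra (subsetP sM c) E'c)) (negPf (contra (subsetP sM' c) E'c)).
Qed.

Lemma exists_lattice_points P : (forall M, P M -> M \subset edges e) ->
  exists N (a : N.-tuple 'X_{1..#|edges e|}), lattice_points (edge_set_polytope P) a.
Proof.
move=> sPE; exists _, (in_tuple [seq indicator M | M <- enum P]); split.
  rewrite map_inj_in_uniq ?enum_uniq // => M M'; rewrite !mem_enum => PM PM'.
  by apply: indicator_inj; apply: sPE.
move=> m; rewrite edge_set_polytopeP; split=> [/mapP[M] | [M PM ->]].
  by rewrite mem_enum => PM ->; exists M.
by apply: map_f; rewrite mem_enum.
Qed.

Lemma lattice_points_enum P N (a : N.-tuple 'X_{1..#|edges e|}) :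
    lattice_points (edge_set_polytope P) a ->
  exists M : 'I_N -> {set {set V}},
    [/\ forall i, P (M i), forall i, tnth a i = indicator (M i)
      & forall M', P M' -> exists i, tnth a i = indicator M'].
Proof.
move=> [_ aP].
have a_edge_set i : exists2 M, P M & tnth a i = indicator M.
  exact/edge_set_polytopeP/aP/mem_tnth.
have /fin_all_exists2[M PM def_a] := a_edge_set.
exists M; split=> // M' PM'.
have /tnthP[i ->] : indicator M' \in a by apply/aP/edge_set_polytopeP; exists M'.
by exists i.
Qed.

End EdgeSetPolytopes.

(** * Fibre compatibility in terms of edge multiplicities *)

(** A monomial is viewed as a multiset of edge sets, and its toric image as the number of these sets
    with the multiplicity of each edge. Letting [c] range over all vertex sets avoids the
    coordinates of the polytopes. *)
Definition multiplicity_compatible (V V' : finType) (P keep : pred {set {set V}})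
    (h : {set {set V}} -> {set {set V'}}) : Prop :=
  forall N (M : 'I_N -> {set {set V}}) (m m' : 'I_N -> nat),
    (forall j, P (M j)) -> (\sum_j m j = \sum_j m' j)%N ->
    (forall c, \sum_j m j * (c \in M j) = \sum_j m' j * (c \in M j))%N ->
    (forall j, (0 < m j)%N -> keep (M j)) ->
  (forall j, (0 < m' j)%N -> keep (M j)) /\
  forall c, (\sum_j m j * (c \in h (M j)) = \sum_j m' j * (c \in h (M j)))%N.

Lemma multiplicity_fibre_compatible (V V' : finType) (e : rel V) (e' : rel V')
    (P keep : pred {set {set V}}) h n n' (b : n.-tuple 'X_{1..#|edges e|})
    (a : n'.-tuple 'X_{1..#|edges e'|}) (M : 'I_n -> {set {set V}})
    (M' : 'I_n' -> {set {set V'}}) (g : 'I_n -> option 'I_n') :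
    (forall M, P M -> M \subset edges e) -> multiplicity_compatible P keep h ->
    (forall i, P (M i)) -> (forall i, tnth b i = indicator e (M i)) ->
    (forall i, tnth a i = indicator e' (M' i)) ->
    (forall j, if g j is Some i then keep (M j) && (M' i == h (M j)) else ~~ keep (M j)) ->
  fibre_compatible b a g.
Proof.
move=> sPE compat PM def_b def_a gP m m'; rewrite !mdegE => eq_deg eq_sum g_m.
have keepE j : keep (M j) = g j :> bool.
  by case: (g j) (gP j) => [i /andP[-> _] | /negPf ->].
have [|j m_j|keep' eq_sum'] := compat _ M m m' PM eq_deg.
- move=> c; have [E_c | E'c] := boolP (c \in edges e).
    have := eq_sum (enum_rank_in E_c c).
    by under eq_bigr do rewrite def_b mnmE enum_rankK_in //;
      under [in RHS]eq_bigr do rewrite def_b mnmE enum_rankK_in //.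
  (* A set that is not an edge has multiplicity 0 on both sides. *)
  by rewrite !big1 // => j _; rewrite (negPf (contra (subsetP (sPE _ (PM j)) c) E'c)) muln0.
- by rewrite keepE g_m.
have g_m' j : (0 < m' j)%N -> g j by move/keep'; rewrite keepE.
split=> // c.
have hE (q : 'X_{1..n}) : (forall j, (0 < q j)%N -> g j) ->
    (\sum_j q j * oapp (fun i => tnth a i c) 0 (g j) =
     \sum_j q j * (enum_val c \in h (M j)))%N.
  move=> g_q; apply: eq_bigr => j _; case: (posnP (q j)) => [-> // | /g_q].
  by case: (g j) (gP j) => //= i /andP[_ /eqP <-] _; rewrite def_a mnmE.
by rewrite !hE.
Qed.

(** Lattice points correspond to edge sets, so [f] induces a map of indices [F], and [g] a partial
    one, [G], defined where [keep] holds. *)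
Lemma is_toric_omega_retract (R : realType) (K : fieldType) (V V' : finType)
    (e : rel V) (e' : rel V') (P : pred {set {set V}}) (P' keep : pred {set {set V'}}) f g w :
    (forall M, P M -> M \subset edges e) -> (forall M, P' M -> M \subset edges e') ->
    (forall M, P M -> [/\ P' (f M), keep (f M) & g (f M) = M]) ->
    (forall M, P' M -> keep M -> P (g M)) ->
    multiplicity_compatible P predT f -> multiplicity_compatible P' keep g -> (2 <= w)%N ->
  (exists2 w', is_toric_omega K (@edge_set_polytope R V' e' P') w' & (w' <= w)%N) ->
  exists2 w', is_toric_omega K (@edge_set_polytope R V e P) w' & (w' <= w)%N.
Proof.
move=> sPE sPE' PfP PgP compat_f compat_g w_ge2 [w' [N' [b [b_pts omega_b]]] le_w'w].
have [N [a a_pts]] := exists_lattice_points R sPE.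
have [M [PM def_a a_full]] := lattice_points_enum a_pts.
have [M' [PM' def_b b_full]] := lattice_points_enum b_pts.
have /fin_all_exists[F FP] : forall i, exists j, M' j = f (M i).
  move=> i; have [P'f _ _] := PfP _ (PM i).
  have [j b_j] := b_full _ P'f; exists j.
  by apply: (@indicator_inj _ e'); rewrite ?sPE' // -def_b.
have /fin_all_exists[G GP] : forall j, exists o : option 'I_N,
    if o is Some i then keep (M' j) && (M i == g (M' j)) else ~~ keep (M' j).
  move=> j; have [keep_j | keep'j] := boolP (keep (M' j)); last by exists None.
  have Pg := PgP _ (PM' j) keep_j; have [i a_i] := a_full _ Pg; exists (Some i).
  by apply/eqP/(@indicator_inj _ e); rewrite ?sPE // -def_a.
have [|||||w'' omega_a le_w''w] := @toric_omega_retract K _ _ _ _ a b F G w.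
- move=> i; have [P'f keep_f gf] := PfP _ (PM i).
  have := GP (F i); rewrite FP keep_f; case: (G (F i)) => //= i'; rewrite gf => /eqP eqM.
  congr Some; apply/(tuple_uniqP a); first by case: a_pts.
  by rewrite !def_a eqM.
- apply: (multiplicity_fibre_compatible sPE compat_f PM def_a def_b) => i /=.
  by rewrite FP eqxx.
- apply: (multiplicity_fibre_compatible sPE' compat_g PM' def_b def_a) => j.
  by have := GP j; case: (G j).
- by [].
- by exists w'.
by exists w'' => //; exists N, a.
Qed.

(** * Matchings and the face of perfect matchings *)

Lemma edgesP (V : finType) (e : rel V) c :
  reflect (exists x y, e x y /\ c = [set x; y]) (c \in edges e).
Proof.
apply: (iffP imset2P) => [[x y _ /=] | [x [y [exy ->]]]].
  by rewrite inE => exy ->; exists x, y.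
by exists x y; rewrite ?inE.
Qed.

Lemma trivIset_memP (V : finType) (P : {set {set V}}) :
  reflect (forall A B x, A \in P -> B \in P -> x \in A -> x \in B -> A = B) (trivIset P).
Proof.
apply: (iffP trivIsetP) => [trivP A B x PA PB Ax Bx | trivP A B PA PB].
  by apply/eqP/negPn/negP => /(trivP A B PA PB)/disjointFr/(_ Ax); rewrite Bx.
apply: contraNT => /pred0Pn[x /andP[Ax Bx]]; exact/eqP/(trivP A B x).
Qed.

(** By disjointness at most one member of [P] contains [x], so the sum is 0 or 1. *)
Lemma trivIset_mem_cover (V : finType) (P : {set {set V}}) x :
  trivIset P -> (x \in cover P : nat) = (\sum_(c : {set V} | x \in c) (c \in P))%N.
Proof.
move=> /trivIset_memP trivP.
have [/bigcupP[A PA Ax] | x'P] := boolP (x \in cover P).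
  rewrite (bigD1 A) //= PA big1 // => B /andP[Bx neq_BA].
  by apply/eqP; rewrite eqb0; apply: contra neq_BA => PB; apply/eqP/(trivP B A x).
rewrite big1 // => A Ax; apply/eqP; rewrite eqb0.
by apply: contra x'P => PA; apply/bigcupP; exists A.
Qed.

Section Matchings.
Variables (V : finType) (e : rel V).

(* Perfect matchings are the matchings [M] maximizing the linear functional
   [\sum_(c in M) #|c|], so they span a face of the matching polytope. *)
Lemma perfect_matching_compatible :
  multiplicity_compatible (is_matching e) (fun M => cover M == [set: V]) id.
Proof.
move=> N M m m' matchM eq_m eq_sum keep_m; split=> // j m'_j.
have card_cover i : #|cover (M i)| = (\sum_(c : {set V}) #|c| * (c \in M i))%N.
  have /andP[_ /eqP<-] := matchM i.
  by rewrite big_mkcond; apply: eq_bigr => c _; case: (_ \in _); rewrite ?muln1 ?muln0.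
have swap (q : 'I_N -> nat) : (\sum_i q i * #|cover (M i)| =
    \sum_(c : {set V}) #|c| * \sum_i q i * (c \in M i))%N.
  under eq_bigr do rewrite card_cover big_distrr /=.
  rewrite exchange_big; apply: eq_bigr => c _; rewrite big_distrr.
  by apply: eq_bigr => i _; rewrite mulnCA.
have full_m : (\sum_i m i * #|cover (M i)| = \sum_i m i * #|V|)%N.
  apply: eq_bigr => i _; case: (posnP (m i)) => [-> // | /keep_m/eqP->].
  by rewrite cardsT.
(* The functional depends on edge multiplicities only, so [m'] attains the maximum as well; a
   non-perfect matching occurring in [m'] would make its total strictly smaller. *)
have full_m' : (\sum_i m' i * #|cover (M i)| = \sum_i m' i * #|V|)%N.
  rewrite -big_distrl -eq_m big_distrl -full_m !swap.
  by apply: eq_bigr => c _; rewrite eq_sum.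
rewrite eqEcard subsetT cardsT leqNgt; apply/negP => lt_cover.
have := ltnn (\sum_i m' i * #|V|)%N; rewrite -{1}full_m' => /negP; apply.
rewrite (bigD1 j) //= [X in (_ < X)%N](bigD1 j) //= -addSn leq_add ?ltn_pmul2l //.
by apply: leq_sum => i _; rewrite leq_mul2l max_card orbT.
Qed.

(** * The prism over a graph *)

(** The Cartesian product of the graph with a single edge. *)
Definition prism : rel (V * bool) :=
  fun p q => (p.2 == q.2) && e p.1 q.1 || (p.2 != q.2) && (p.1 == q.1).

Definition copy (s : bool) (c : {set V}) : {set V * bool} := setX c [set s].
Definition rung (v : V) : {set V * bool} := setX [set v] setT.

Definition prism_matching (M : {set {set V}}) : {set {set V * bool}} :=
  [set copy s c | c in M, s in [set: bool]] :|: [set rung v | v in ~: cover M].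

Definition prism_trace (M : {set {set V * bool}}) : {set {set V}} :=
  copy false @^-1: M.

Lemma prism_simple_graph : simple_graph e -> simple_graph prism.
Proof.
move=> [sym_e irr_e]; split=> [p q | p]; rewrite /prism.
  by rewrite sym_e [p.2 == _]eq_sym [p.1 == _]eq_sym.
by rewrite irr_e !eqxx andbF.
Qed.

Lemma prism_matchingP (M : {set {set V}}) c' :
  reflect ((exists s c, c \in M /\ c' = copy s c) \/
           (exists v, v \notin cover M /\ c' = rung v)) (c' \in prism_matching M).
Proof.
rewrite inE; apply: (iffP orP) => -[].
- by case/imset2P => c s Mc _ ->; left; exists s, c.
- by case/imsetP => v; rewrite inE => v'M ->; right; exists v.
- by case=> s [c [Mc ->]]; left; apply/imset2P; exists c s; rewrite ?inE.
by case=> v [v'M ->]; right; apply/imsetP; exists v; rewrite ?inE.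
Qed.

Lemma mem_copy s c p : (p \in copy s c) = (p.1 \in c) && (p.2 == s).
Proof. by case: p => v t; rewrite in_setX in_set1. Qed.

Lemma mem_rung v p : (p \in rung v) = (p.1 == v).
Proof. by case: p => u t; rewrite in_setX in_set1 in_setT andbT. Qed.

Lemma copy_inj s : injective (copy s).
Proof.
by move=> c d /setP eq_cd; apply/setP => v; have := eq_cd (v, s); rewrite !mem_copy eqxx !andbT.
Qed.

Lemma copy_neq_rung s c v : copy s c <> rung v.
Proof. by move/setP/(_ (v, ~~ s)); rewrite mem_copy mem_rung eqxx; case: s; rewrite andbF. Qed.

Lemma rung_inj : injective rung.
Proof. by move=> u v /setP/(_ (u, true)); rewrite !mem_rung eqxx => /esym/eqP. Qed.

Lemma mem_prism_matching_copy (M : {set {set V}}) s c :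
  M \subset edges e -> (copy s c \in prism_matching M) = (c \in M).
Proof.
move=> sME; apply/prism_matchingP/idP => [[[t [d [Md eq_cd]]] | [v [_ /copy_neq_rung]]] // | Mc].
  (* The edge [d] is nonempty, so its vertex [x] reveals that the two layers agree. *)
  have /edgesP[x [y [_ def_d]]] := subsetP sME _ Md.
  have /setP/(_ (x, t)) := eq_cd; rewrite !mem_copy def_d !inE !eqxx /=.
  by case/andP => _ /eqP eq_ts; move: eq_cd; rewrite eq_ts => /copy_inj->.
by left; exists s, c.
Qed.

Lemma mem_prism_matching_rung (M : {set {set V}}) v : (rung v \in prism_matching M) = (v \notin cover M).
Proof.
apply/prism_matchingP/idP => [[[s [c [_ /esym/copy_neq_rung]]] | [u [u'M /rung_inj->]]] // | v'M].
by right; exists v.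
Qed.

Lemma prism_matchingK (M : {set {set V}}) : M \subset edges e -> prism_trace (prism_matching M) = M.
Proof. by move=> sME; apply/setP => c; rewrite inE mem_prism_matching_copy. Qed.

Lemma prism_matching_perfect M :
  is_matching e M -> is_perfect_matching prism (prism_matching M).
Proof.
move=> /andP[sME /trivIset_memP trivM]; rewrite /is_perfect_matching /is_matching -andbA.
apply/and3P; split.
- apply/subsetP => c' /prism_matchingP[[s [c [Mc ->]]] | [v [_ ->]]]; apply/edgesP.
    have /edgesP[x [y [exy ->]]] := subsetP sME _ Mc.
    exists (x, s), (y, s); rewrite /prism /= eqxx exy; split=> //.
    by apply/setP => -[v t]; rewrite mem_copy !inE !xpair_eqE -andb_orl.
  exists (v, true), (v, false); rewrite /prism /= eqxx; split=> //.
  by apply/setP => -[u t]; rewrite mem_rung !inE !xpair_eqE /=; case: t; rewrite ?andbT ?andbF ?orbF.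
(* A copy and a rung never meet, because rungs stand only at uncovered vertices; two copies through
   [p] share its layer and hence come from the same edge of [M]. *)
- apply/trivIset_memP => A B p.
  case/prism_matchingP => [[s [c [Mc ->]]] | [v [v'M ->]]];
  case/prism_matchingP => [[t [d [Md ->]]] | [u [u'M ->]]]; rewrite ?mem_copy ?mem_rung.
  + by case/andP => cp /eqP<- /andP[dp /eqP<-]; rewrite (trivM c d p.1).
  + by case/andP => cp _ /eqP def_u; case/bigcupP: u'M; exists c; rewrite -?def_u.
  + by move/eqP => def_v /andP[dp _]; case/bigcupP: v'M; exists d; rewrite -?def_v.
  by move=> /eqP<- /eqP<-.
apply/eqP/setP => -[v s]; rewrite inE.
have [/bigcupP[c Mc cv] | v'M] := boolP (v \in cover M); apply/bigcupP.
  by exists (copy s c); rewrite ?mem_copy ?cv ?eqxx //; apply/prism_matchingP; left; exists s, c.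
by exists (rung v); rewrite ?mem_rung //; apply/prism_matchingP; right; exists v.
Qed.

Lemma prism_trace_matching M : is_matching prism M -> is_matching e (prism_trace M).
Proof.
move=> /andP[/subsetP sME /trivIset_memP trivM]; apply/andP; split.
  apply/subsetP => c; rewrite inE => /sME/edgesP[[x s] [[y t] [pxy eq_c]]].
  (* Both ends of an edge [copy false c] lie in the layer [false], so the edge is not a rung and
     comes from [e]. *)
  have := mem_copy false c (x, s); rewrite eq_c !inE eqxx /= => /esym/andP[_ /eqP eq_s].
  have := mem_copy false c (y, t); rewrite eq_c !inE eqxx orbT /= => /esym/andP[_ /eqP eq_t].
  apply/edgesP; exists x, y; split.
    by move: pxy; rewrite /prism eq_s eq_t eqxx orbF.
  apply/setP => v; have /setP/(_ (v, false)) := eq_c.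
  by rewrite mem_copy eqxx andbT eq_s eq_t !inE !xpair_eqE !eqxx !andbT.
apply/trivIset_memP => A B x; rewrite !inE => MA MB Ax Bx.
by apply/(copy_inj (s := false))/(trivM _ _ (x, false)) => //; rewrite mem_copy ?Ax ?Bx eqxx.
Qed.

(* A rung at [v] lies in [prism_matching M] exactly when no edge of [M] meets
   [v], so its multiplicity is the number of matchings minus that of the edges
   at [v]. *)
Lemma prism_matching_compatible :
  multiplicity_compatible (is_matching e) predT prism_matching.
Proof.
move=> N M m m' matchM eq_m eq_sum _; split=> // c'.
have sME j : M j \subset edges e by case/andP: (matchM j).
have [[v ->] | not_rung] := EM (exists v, c' = rung v).
  have rungE (q : 'I_N -> nat) : (\sum_j q j * (rung v \in prism_matching (M j)) +
      \sum_(c : {set V} | v \in c) \sum_j q j * (c \in M j) = \sum_j q j)%N.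
    rewrite exchange_big -big_split /=; apply: eq_bigr => j _.
    rewrite -big_distrr -trivIset_mem_cover /=; last by case/andP: (matchM j).
    by rewrite mem_prism_matching_rung -mulnDr; case: (_ \in _); rewrite muln1.
  have := rungE m; rewrite eq_m -(rungE m') => /eqP.
  rewrite [X in (_ + X)%N == _](eq_bigr _ (fun c _ => eq_sum c)).
  by rewrite eqn_add2r => /eqP.
have [[s [c ->]] | not_copy] := EM (exists s c, c' = copy s c).
  by under eq_bigr do rewrite mem_prism_matching_copy //;
     under [in RHS]eq_bigr do rewrite mem_prism_matching_copy //.
have notin j : (c' \in prism_matching (M j)) = false.
  apply/prism_matchingP => -[[s [c [_ def_c]]] | [v [_ def_v]]].
    by case: not_copy; exists s, c.
  by case: not_rung; exists v.
by rewrite !big1 // => j _; rewrite notin muln0.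
Qed.

(** The multiplicity of [c] among the traces is that of [copy false c] among the original sets. *)
Lemma prism_trace_compatible (P : pred {set {set V * bool}}) :
  multiplicity_compatible P predT prism_trace.
Proof.
move=> N M m m' _ _ eq_sum _; split=> // c.
by under eq_bigr do rewrite inE; under [in RHS]eq_bigr do rewrite inE; apply: eq_sum.
Qed.

End Matchings.

Theorem proposition6p10 (R : realType) (K : fieldType) :
  (forall (V : finType) (e : rel V), simple_graph e ->
     exists2 w : nat,
       is_toric_omega K (@matching_polytope R V e) w & (w <= 4)%N)
  <->
  (forall (V : finType) (e : rel V), simple_graph e ->
     exists2 w : nat,
       is_toric_omega K (@perfect_matching_polytope R V e) w & (w <= 4)%N).
Proof.
split=> omega_le4 V e simple_e.
  (* Restriction to a face: [keep] selects the perfect matchings among all matchings of the same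
     graph. *)
  apply: (is_toric_omega_retract (P := is_perfect_matching e) (P' := is_matching e)
    (keep := fun M => cover M == [set: V]) (f := id) (g := id) (e' := e)) => //.
  - by move=> M /andP[/andP[]].
  - by move=> M /andP[].
  - by move=> M /andP[].
  - by move=> M matchM coverM; apply/andP.
  - exact: perfect_matching_compatible.
  exact: omega_le4.
(* Here no variable is killed: the trace of every perfect matching of the prism is a matching. *)
apply: (is_toric_omega_retract (P := is_matching e) (P' := is_perfect_matching (prism e))
  (keep := predT) (f := @prism_matching V) (g := @prism_trace V) (e' := prism e)) => //.
- by move=> M /andP[].
- by move=> M /andP[/andP[]].
- move=> M matchM; split=> //; first exact: prism_matching_perfect.
  by case/andP: matchM => sME _; apply: (prism_matchingK sME).
- by move=> M /andP[matchM _] _; apply: prism_trace_matching.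
- exact: prism_matching_compatible.
- exact: prism_trace_compatible.
exact/omega_le4/prism_simple_graph.
Qed.
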